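(* Let $\Bbbk$ be a commutative ring and let $(R,C,\partial,\mathrm{tr})$ be a Poisson trace order over $\Bbbk$ with $C$ an integral domain. Let $A$ be a Poisson subalgebra of $C$ which is normal considered as a commutative algebra and such that $C$ is a finitely generated $A$-module. Then $(R,A,\partial|_A,\mathrm{tr}_{C/A}\circ\mathrm{tr})$ is a Poisson trace order.
   Context: $\Bbbk$ is a commutative base ring; algebras are associative unital $\Bbbk$-algebras and Poisson algebras are commutative with $\Bbbk$-bilinear Poisson bracket. $\mathrm{Der}_\Bbbk(R)$ denotes $\Bbbk$-linear derivations of $R$. Poisson order: a triple $(R,C,\partial)$ where $C$ is a central $\Bbbk$-subalgebra of the $\Bbbk$-algebra $R$, $R$ is a finitely generated $C$-module, $C$ is equipped with a Poisson algebra structure $\{.,.\}$, and $\partial:C\to\mathrm{Der}_\Bbbk(R)$, $c\mapsto\partial_c$, is a $\Bbbk$-linear map such that $\partial_c|_C=\{c,-\}$ for all $c\in C$. Trace map: a map $\mathrm{tr}:R\to C$ that is $C$-linear and satisfies $\mathrm{tr}(xy)=\mathrm{tr}(yx)$ for all $x,y\in R$. Poisson trace order: a quadruple $(R,C,\partial,\mathrm{tr})$ with $(R,C,\partial)$ a Poisson order and $\mathrm{tr}:R\to C$ a trace map such that $\mathrm{tr}(\partial_c(r))=\{c,\mathrm{tr}(r)\}$ for all $c\in C$, $r\in R$. Trace $\mathrm{tr}_{C/A}$: for an integral domain $C$ finite over a normal (integrally closed) subdomain $A$, with fraction fields $\mathcal{F}(C)\supseteq\mathcal{F}(A)$, $\mathrm{tr}_{C/A}:C\to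 A$ is the restriction to $C$ of the trace $\mathrm{tr}_{\mathcal{F}(C)/\mathcal{F}(A)}$ of the finite field extension (the trace of the $\mathcal{F}(A)$-linear operator of multiplication on $\mathcal{F}(C)$); by normality of $A$ it takes values in $A$. *)

(* Defs.v *)
From HB Require Import structures.
From mathcomp Require Import all_boot all_algebra.
From mathcomp Require Import generic_quotient classical_sets.

Set Implicit Arguments.
Unset Strict Implicit.
Unset Printing Implicit Defensive.

Import GRing.Theory.
Local Open Scope ring_scope.

#[short(type="idomainAlgType")]
HB.structure Definition IdomainAlgebra (k : comPzRingType) :=
  {C of GRing.ComUnitAlgebra k C & GRing.IntegralDomain C}.

Section PoissonOrders.
Variable k : comPzRingType.

Definition is_derivation (R : algType k) (d : R -> R) :=
  (forall (t : k) x y, d (t *: x + y) = t *: d x + d y) /\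
  (forall x y, d (x * y) = d x * y + x * d y).

(* Since k is arbitrary (2 may be a zero divisor), the bracket is required to
   be alternating, which implies that it is skew-symmetric. *)
Record is_poisson_bracket (C : comAlgType k) (br : C -> C -> C) : Prop :=
  IsPoissonBracket {
    poisson_linearl : forall (t : k) a b c,
      br (t *: a + b) c = t *: br a c + br b c;
    poisson_linearr : forall (t : k) a b c,
      br c (t *: a + b) = t *: br c a + br c b;
    poisson_alternating : forall a, br a a = 0;
    poisson_jacobi : forall a b c,
      br a (br b c) + br b (br c a) + br c (br a b) = 0;
    poisson_leibniz : forall a b c, br a (b * c) = br a b * c + b * br a c
  }.

(* A subalgebra is given by an injective morphism of algebras; iota : C -> R
   exhibits C as a k-subalgebra of R. *)
Record is_poisson_order (R : algType k) (C : comAlgType k)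
    (iota : {lrmorphism C -> R}) (br : C -> C -> C) (der : C -> R -> R) : Prop :=
  IsPoissonOrder {
    order_inj : injective iota;
    order_central : forall c x, iota c * x = x * iota c;
    order_finite : exists (n : nat) (r : 'I_n -> R),
      forall x, exists a : 'I_n -> C, x = \sum_i iota (a i) * r i;
    order_poisson : is_poisson_bracket br;
    order_derivation : forall c, is_derivation (der c);
    order_linear : forall (t : k) c c' x,
      der (t *: c + c') x = t *: der c x + der c' x;
    order_compat : forall c c', der c (iota c') = iota (br c c')
  }.

Definition is_trace_map (R : algType k) (C : comAlgType k)
    (iota : C -> R) (tr : R -> C) :=
  (forall c x y, tr (iota c * x + y) = c * tr x + tr y) /\
  (forall x y, tr (x * y) = tr (y * x)).

Definition is_poisson_trace_order (R : algType k) (C : comAlgType k)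
    (iota : {lrmorphism C -> R}) (br : C -> C -> C) (der : C -> R -> R)
    (tr : R -> C) :=
  [/\ is_poisson_order iota br der, is_trace_map iota tr
    & forall c x, tr (der c x) = br c (tr x)].

(* j exhibits A as a subalgebra of (C, brC) closed under the bracket, brA being
   the bracket induced on A. *)
Definition is_poisson_subalgebra (A C : comAlgType k) (j : {lrmorphism A -> C})
    (brA : A -> A -> A) (brC : C -> C -> C) :=
  injective j /\ forall a b, j (brA a b) = brC (j a) (j b).

End PoissonOrders.

Definition is_normal (A : idomainType) :=
  forall x : {fraction A},
    integralOver (@tofrac A) x -> exists a : A, x = tofrac a.

Definition is_finite_over (A C : comNzRingType) (j : A -> C) :=
  exists (n : nat) (e : 'I_n -> C),
    forall c, exists a : 'I_n -> A, c = \sum_i j (a i) * e i.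

Section FieldTrace.
Variables (K L : fieldType) (i : K -> L).

Definition is_field_basis n (e : 'I_n -> L) :=
  forall y : L, exists! a : 'rV[K]_n, y = \sum_l i (a 0 l) * e l.

Definition is_mul_matrix n (e : 'I_n -> L) (x : L) (M : 'M[K]_n) :=
  forall m, x * e m = \sum_l i (M m l) * e l.

(* The trace of the K-linear operator y |-> x * y of L (0 if L is not finite
   over K). *)
Definition field_trace (x : L) : K :=
  xget 0 [set t | exists n (e : 'I_n -> L) (M : 'M[K]_n),
    [/\ is_field_basis e, is_mul_matrix e x M & t = \tr M]].

End FieldTrace.

(* The inclusion of fraction fields induced by an injective j : A -> C. *)
Definition frac_map (A C : idomainType) (j : A -> C) (x : {fraction A}) :
    {fraction C} :=
  tofrac (j \n_(repr x)) / tofrac (j \d_(repr x)).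

(* tr_{C/A}: the value is 0 where the trace of the fraction fields does not lie
   in A; this does not occur when A is normal. *)
Definition trace_over (A C : idomainType) (j : A -> C) (c : C) : A :=
  xget 0 [set a | tofrac a = field_trace (frac_map j) (tofrac c)].

Section FieldTraceTheory.
Variables (K L : fieldType) (i : {rmorphism K -> L}).

Lemma basis_coord_inj n (e : 'I_n -> L) (a b : 'rV[K]_n) :
  is_field_basis i e ->
  \sum_l i (a 0 l) * e l = \sum_l i (b 0 l) * e l -> a = b.
Proof.
move=> He Hab; have [c [_ Hc]] := He (\sum_l i (a 0 l) * e l).
by rewrite -(Hc a) // -(Hc b).
Qed.

Lemma basis_mx m n (e : 'I_n -> L) (f : 'I_m -> L) :
  is_field_basis i e ->
  exists P : 'M[K]_(m, n), forall l, f l = \sum_h i (P l h) * e h.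
Proof.
move=> He; have H l : exists a : 'rV[K]_n, f l == \sum_h i (a 0 h) * e h.
  by have [a [/eqP Ha _]] := He (f l); exists a.
exists (\matrix_(l, h) (xchoose (H l)) 0 h) => l.
rewrite {1}(eqP (xchooseP (H l))); apply: eq_bigr => h _; by rewrite mxE.
Qed.

Lemma mul_comb m n p (P : 'M[K]_(m, n)) (Q : 'M[K]_(n, p)) (e : 'I_p -> L) l :
  \sum_h i (P l h) * (\sum_g i (Q h g) * e g) =
  \sum_g i ((P *m Q) l g) * e g.
Proof.
under eq_bigr => h _ do rewrite mulr_sumr.
rewrite exchange_big /=; apply: eq_bigr => g _.
rewrite mxE rmorph_sum mulr_suml; apply: eq_bigr => h _.
by rewrite rmorphM mulrA.
Qed.

Lemma basis_mx_inj m n (e : 'I_n -> L) (P Q : 'M[K]_(m, n)) :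
  is_field_basis i e ->
  (forall l, \sum_h i (P l h) * e h = \sum_h i (Q l h) * e h) -> P = Q.
Proof.
move=> He HPQ; apply/row_matrixP => l; apply: (basis_coord_inj He).
under eq_bigr => h _ do rewrite mxE.
by under [RHS]eq_bigr => h _ do rewrite mxE.
Qed.

Lemma trace_indep m n (e : 'I_m -> L) (f : 'I_n -> L) x M N :
  is_field_basis i e -> is_field_basis i f ->
  is_mul_matrix i e x M -> is_mul_matrix i f x N -> \tr M = \tr N.
Proof.
move=> He Hf HM HN.
have [P HP] := basis_mx e Hf; have [Q HQ] := basis_mx f He.
have QP : Q *m P = 1%:M.
  apply: (basis_mx_inj Hf) => l; rewrite -mul_comb.
  under eq_bigr => h _ do rewrite -HP.
  rewrite -HQ (bigD1 l) //= mxE eqxx rmorph1 mul1r big1 ?addr0 // => h hl.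
  by rewrite mxE eq_sym (negPf hl) rmorph0 mul0r.
have MP : M *m P = P *m N.
  apply: (basis_mx_inj Hf) => l; rewrite -2!mul_comb.
  under eq_bigr => h _ do rewrite -HP.
  under [RHS]eq_bigr => h _ do rewrite -HN.
  rewrite -HM (HP l) mulr_sumr; apply: eq_bigr => h _; by rewrite mulrCA.
have PQ : P *m Q = 1%:M.
  apply: (basis_mx_inj He) => l; rewrite -mul_comb.
  under eq_bigr => h _ do rewrite -HQ.
  rewrite -HP (bigD1 l) //= mxE eqxx rmorph1 mul1r big1 ?addr0 // => h hl.
  by rewrite mxE eq_sym (negPf hl) rmorph0 mul0r.
by rewrite -[M]mulmx1 -PQ mulmxA MP -mulmxA mxtrace_mulC -mulmxA QP mulmx1.
Qed.

Lemma field_traceE n (e : 'I_n -> L) x (M : 'M[K]_n) :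
  is_field_basis i e -> is_mul_matrix i e x M -> field_trace i x = \tr M.
Proof.
move=> He HM; apply: xget_unique; first by exists n, e, M.
by move=> t [m [f [N [Hf HN ->]]]]; apply: (trace_indep Hf He HN HM).
Qed.

End FieldTraceTheory.

Section FracMap.
Variables (A C : idomainType) (j : {rmorphism A -> C}) (j_inj : injective j).

Lemma frac_repr (R : idomainType) (x : {fraction R}) :
  x = tofrac \n_(repr x) / tofrac \d_(repr x).
Proof.
have d0 := denom_ratioP (repr x).
apply: (mulIf (x := tofrac \d_(repr x))); first by rewrite tofrac_eq0.
rewrite divfK ?tofrac_eq0 //.
rewrite -{1}[x]reprK; unlock FracField.tofrac.
rewrite -[LHS]FracField.pi_mul; apply/eqmodP; rewrite /= FracField.equivfE.
rewrite /FracField.mulf /= !numden_Ratio ?oner_neq0 ?mulf_neq0 ?oner_neq0 //.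
by rewrite !mulr1 mulrC.
Qed.

Lemma j_neq0 a : a != 0 -> j a != 0.
Proof. by apply: contraNneq => /eqP; rewrite -(rmorph0 j) (inj_eq j_inj). Qed.

Lemma frac_map_div (n d : A) : d != 0 ->
  frac_map j (tofrac n / tofrac d) = tofrac (j n) / tofrac (j d).
Proof.
move=> d0; rewrite /frac_map; set x := tofrac n / tofrac d.
have e0 := denom_ratioP (repr x).
have: tofrac n / tofrac d = tofrac \n_(repr x) / tofrac \d_(repr x).
  by rewrite -frac_repr.
move/eqP; rewrite eqr_div ?tofrac_eq0 // -!tofracM tofrac_eq => /eqP E.
apply/eqP; rewrite eqr_div ?tofrac_eq0 ?j_neq0 //.
by rewrite -!tofracM tofrac_eq -!rmorphM E.
Qed.

Lemma frac_map_tofrac a : frac_map j (tofrac a) = tofrac (j a).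
Proof.
rewrite -[tofrac a]divr1 -tofrac1 frac_map_div ?oner_neq0 //.
by rewrite rmorph1 tofrac1 divr1.
Qed.

Lemma frac_map_is_zmod_morphism : zmod_morphism (frac_map j).
Proof.
move=> x y; rewrite (frac_repr x) (frac_repr y).
have dx := denom_ratioP (repr x); have dy := denom_ratioP (repr y).
rewrite -mulNr addf_div ?tofrac_eq0 // -tofracN -!tofracM -tofracD.
rewrite !frac_map_div ?mulf_neq0 // -mulNr addf_div ?tofrac_eq0 ?j_neq0 //.
by rewrite !(rmorphD, rmorphM, rmorphN).
Qed.

Lemma frac_map_is_monoid_morphism : monoid_morphism (frac_map j).
Proof.
split=> [|x y]; first by rewrite -tofrac1 frac_map_tofrac rmorph1.
rewrite (frac_repr x) (frac_repr y).
have dx := denom_ratioP (repr x); have dy := denom_ratioP (repr y).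
rewrite mulf_div -!tofracM !frac_map_div ?mulf_neq0 // mulf_div.
by rewrite -!tofracM !rmorphM.
Qed.

End FracMap.

(* Main.v *)
(* Generators of C over A contain a basis e of F(C) over F(A). Let M be the
   matrix of multiplication by c in this basis. A derivation d of C preserving A
   extends to the fraction fields; differentiating c * e = M e shows that the
   matrix of d(c) differs from d(M) by a commutator, so the trace commutes with
   d. This requires no separability.
   The trace of M is integral over A: in the coordinates given by e, the maximal
   minors of generators of C over A span a nonzero finitely generated A-submodule
   of F(A), stable under multiplication by the trace. *)
Require Import Defs.
From HB Require Import structures.
From mathcomp Require Import all_boot all_algebra.
From mathcomp Require Import boolp classical_sets ring.

Set Implicit Arguments.
Unset Strict Implicit.
Unset Printing Implicit Defensive.

Import GRing.Theory.
Local Open Scope ring_scope.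

(** * Integrality of a trace through maximal minors *)

(** The left side is the trace of [G *m M *m \adj G], which is cyclic. By Laplace expansion it sums
    over [k] the determinants of [G] with row [k] replaced by that of [G *m M]. *)
Lemma sum_mul_cofactor (R : comNzRingType) n (G M : 'M[R]_n) :
  \sum_k \sum_j (G *m M) k j * cofactor G k j = \tr M * \det G.
Proof.
transitivity (\tr (G *m M *m \adj G)).
  apply: eq_bigr => k _; rewrite mxE; apply: eq_bigr => j _.
  by rewrite [X in _ = _ * X]mxE.
by rewrite mxtrace_mulC mulmxA mul_adj_mx mul_scalar_mx mxtraceZ mulrC.
Qed.

(** The cofactors along row [k] do not involve row [k], so they survive its replacement. *)
Lemma det_replace_row (R : comNzRingType) N n (P : 'M[R]_(N, n))
    (f : {ffun 'I_n -> 'I_N}) k l :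
  \sum_j P l j * cofactor (rowsub f P) k j =
  \det (rowsub [ffun h => if h == k then l else f h] P).
Proof.
rewrite (expand_det_row _ k); apply: eq_bigr => j _.
rewrite mxE ffunE eqxx; congr (_ * (_ * \det _)).
by apply/matrixP => a b; rewrite !mxE ffunE [lift k a == k]eq_sym (negPf (neq_lift k a)).
Qed.

(* By [sum_mul_cofactor], multiplying a minor of P by \tr M amounts to replacing
   in turn each of its rows by an A-combination of rows of P. *)
Lemma integral_trace (A : comNzRingType) (K : fieldType)
    (phi : {rmorphism A -> K}) N n (P : 'M[K]_(N, n)) (f0 : 'I_n -> 'I_N)
    (B : 'M[A]_N) (M : 'M[K]_n) :
  rowsub f0 P = 1%:M -> map_mx phi B *m P = P *m M ->
  integralOver phi (\tr M).
Proof.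
move=> Pf0 BP.
pose T := {ffun 'I_n -> 'I_N}.
pose w (f : T) := \det (rowsub f P).
pose upd (f : T) k l : T := [ffun h => if h == k then l else f h].
have trw f : \tr M * w f = \sum_k \sum_l phi (B (f k) l) * w (upd f k l).
  rewrite -sum_mul_cofactor; apply: eq_bigr => k _.
  transitivity (\sum_j \sum_l phi (B (f k) l) * (P l j * cofactor (rowsub f P) k j)).
    apply: eq_bigr => j _.
    have -> : (rowsub f P *m M) k j = (map_mx phi B *m P) (f k) j.
      by rewrite BP !mxE; apply: eq_bigr => h _; rewrite mxE.
    rewrite mxE mulr_suml; apply: eq_bigr => l _.
    by rewrite mxE mulrA.
  rewrite exchange_big; apply: eq_bigr => l _.
  by rewrite -mulr_sumr det_replace_row.
pose ev : 'I_#|{: T}| -> T := enum_val.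
(* Column [s] holds the coefficients from [trw] of [\tr M * w (ev s)]; they are summed because
   several pairs [(k, l)] may give the same updated selection. *)
pose E : 'M[A]_#|{: T}| := \matrix_(s', s)
  \sum_k \sum_l B (ev s k) l * (s' == @enum_rank T (upd (ev s) k l))%:R.
pose v : 'rV[K]_#|{: T}| := \row_s w (ev s).
(* [v] is a left eigenvector of the image of [E] with eigenvalue [\tr M]. *)
exists (char_poly E); first exact: char_poly_monic.
rewrite map_char_poly -eigenvalue_root_char; apply/eigenvalueP; exists v.
  apply/rowP => s; rewrite !mxE trw.
  under eq_bigr => s' _ do rewrite !mxE rmorph_sum mulr_sumr.
  rewrite exchange_big; apply: eq_bigr => k _.
  under eq_bigr => s' _ do rewrite rmorph_sum mulr_sumr.
  rewrite exchange_big; apply: eq_bigr => l _.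
  rewrite (bigD1 (@enum_rank T (upd (ev s) k l))) //= big1 => [|s' /negPf ->].
    by rewrite eqxx mulr1 /ev enum_rankK addr0 mulrC.
  by rewrite mulr0 rmorph0 mulr0.
(* [v] is nonzero: its entry at [f0] is the minor [\det 1%:M = 1]. *)
apply/eqP => /rowP/(_ (@enum_rank T (finfun f0))); rewrite !mxE /ev enum_rankK /w.
suff -> : rowsub (finfun f0) P = 1%:M by rewrite det1 => /eqP; rewrite oner_eq0.
by rewrite -Pf0; apply/matrixP => a b; rewrite !mxE ffunE.
Qed.

(** * Bases and traces of a finite field extension *)

Section FieldTrace.
Variables (K L : fieldType) (i : {rmorphism K -> L}).

Lemma basisP n (e : 'I_n -> L) :
  (forall a : 'rV[K]_n, \sum_l i (a 0 l) * e l = 0 -> a = 0) ->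
  (forall y, exists a : 'rV[K]_n, y = \sum_l i (a 0 l) * e l) ->
  is_field_basis i e.
Proof.
move=> free_e span_e y; have [a Ha] := span_e y; exists a; split=> // b Hb.
apply/eqP; rewrite -subr_eq0; apply/eqP/free_e.
under eq_bigr => l _ do rewrite !mxE rmorphB mulrBl.
by rewrite sumrB -Ha -Hb subrr.
Qed.

Lemma scalar_comb n (e : 'I_n -> L) m : \sum_l i (1%:M m l) * e l = e m.
Proof.
rewrite (bigD1 m) //= big1 => [|l lm]; first by rewrite mxE eqxx rmorph1 mul1r addr0.
by rewrite mxE eq_sym (negPf lm) rmorph0 mul0r.
Qed.

(** Induction on [N]: in a nontrivial relation, a member with nonzero coefficient is a combination
    of the others and can be discarded. *)
Lemma free_subfamily N (g : 'I_N -> L) :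
  exists n (f : 'I_n -> 'I_N) (P : 'M[K]_(N, n)),
    (forall a : 'rV[K]_n, \sum_l i (a 0 l) * g (f l) = 0 -> a = 0) /\
    (forall m, g m = \sum_l i (P m l) * g (f l)).
Proof.
elim: N g => [|N IHN] g.
  by exists 0, id, 0; split=> [a _|[]//]; apply/rowP => -[].
have [free_g|] :=
    pselect (forall a : 'rV[K]_N.+1, \sum_l i (a 0 l) * g l = 0 -> a = 0).
  by exists N.+1, id, 1%:M; split=> // m; rewrite scalar_comb.
move=> /existsNP[a /not_implyP[Ha /eqP/rV0Pn[m am0]]].
have [n [f [P [free_f span_f]]]] := IHN (g \o lift m).
(* [Q] writes [g] in terms of [g \o lift m]: row [m] is the relation solved for [g m], the other
   rows are unit vectors. *)
pose Q : 'M[K]_(N.+1, N) := \matrix_(l, h)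
  if unlift m l is Some l' then (l' == h)%:R else - (a 0 (lift m h) / a 0 m).
exists n, (lift m \o f), (Q *m P); split=> // l.
rewrite -(mul_comb i Q P (g \o lift m \o f)).
under eq_bigr => h _ do rewrite -span_f mxE.
case: unliftP => [l' ->|->].
  rewrite (bigD1 l') //= big1 => [|h /negPf hl].
    by rewrite eqxx rmorph1 mul1r addr0.
  by rewrite eq_sym hl rmorph0 mul0r.
move: Ha; rewrite (bigD1_ord m) //= => /eqP; rewrite addr_eq0 => /eqP Ha.
have iam0 : i (a 0 m) != 0 by rewrite fmorph_eq0.
apply: (mulfI iam0); rewrite Ha mulr_sumr -sumrN; apply: eq_bigr => h _.
by rewrite rmorphN fmorph_div mulrA mulrN mulrCA divff // mulr1 mulNr.
Qed.

Lemma mul_matrix_exists n (e : 'I_n -> L) x :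
  is_field_basis i e -> exists M : 'M[K]_n, is_mul_matrix i e x M.
Proof. by move=> He; apply: (basis_mx (fun l => x * e l) He). Qed.

Lemma field_trace_linear n (e : 'I_n -> L) t x y :
  is_field_basis i e ->
  field_trace i (i t * x + y) = t * field_trace i x + field_trace i y.
Proof.
move=> He.
have [M HM] := mul_matrix_exists x He; have [M' HM'] := mul_matrix_exists y He.
have HN : is_mul_matrix i e (i t * x + y) (t *: M + M').
  move=> m; rewrite mulrDl -mulrA HM HM' mulr_sumr -big_split; apply: eq_bigr => l _.
  by rewrite !mxE rmorphD rmorphM mulrDl mulrA.
rewrite (field_traceE He HM) (field_traceE He HM') (field_traceE He HN).
by rewrite mxtraceD mxtraceZ.
Qed.

Lemma field_trace_derivation n (e : 'I_n -> L) (dK : K -> K) (dL : L -> L) x :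
  is_field_basis i e ->
  {morph dK : a b / a + b} -> {morph dL : a b / a + b} ->
  (forall a b, dL (a * b) = dL a * b + a * dL b) ->
  (forall a, dL (i a) = i (dK a)) ->
  field_trace i (dL x) = dK (field_trace i x).
Proof.
move=> He dKD dLD dLM dLi.
have dK0 : dK 0 = 0 by apply: (addrI (dK 0)); rewrite -dKD !addr0.
have dL0 : dL 0 = 0 by apply: (addrI (dL 0)); rewrite -dLD !addr0.
have [M HM] := mul_matrix_exists x He.
(* [dL] need not be [K]-linear; [N] only records its values on the basis. *)
have [N HN] := basis_mx (dL \o e) He.
have [M' HM'] := mul_matrix_exists (dL x) He.
rewrite (field_traceE He HM) (field_traceE He HM').
(* Differentiating [x * e = M e] gives [dx * e + x * N e = dM e + M N e]. *)
suff E : M' + N *m M = map_mx dK M + M *m N.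
  have : \tr (M' + N *m M) = \tr (map_mx dK M + M *m N) by rewrite E.
  rewrite !mxtraceD [\tr (N *m M)]mxtrace_mulC => /addIr ->.
  rewrite /mxtrace (big_morph dK dKD dK0).
  by apply: eq_bigr => l _; rewrite mxE.
apply: (basis_mx_inj He) => m.
under eq_bigr => h _ do rewrite mxE rmorphD mulrDl.
under [RHS]eq_bigr => h _ do rewrite mxE rmorphD mulrDl.
rewrite !big_split /= -!mul_comb -HM'.
under [in LHS]eq_bigr => h _ do rewrite -HM mulrCA.
under [X in _ = _ + X]eq_bigr => h _ do rewrite -HN.
rewrite -mulr_sumr -HN -dLM HM (big_morph dL dLD dL0) -big_split.
by apply: eq_bigr => h _; rewrite dLM dLi mxE.
Qed.

End FieldTrace.

(** * Extension of a derivation to the fraction field *)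

Section FracDerivation.
Variables (R : idomainType) (d : R -> R).
Hypothesis dD : {morph d : x y / x + y}.
Hypothesis dM : forall x y, d (x * y) = d x * y + x * d y.

Definition frac_der (x : {fraction R}) : {fraction R} :=
  (tofrac (d \n_(repr x)) - x * tofrac (d \d_(repr x))) / tofrac \d_(repr x).

(** Independence of the representative, in division-free form: differentiating [n * e' = n' * e] in
    [R] compares [n / e] with the chosen fraction [n' / e']. *)
Lemma frac_derE n e (x : {fraction R}) : e != 0 -> x * tofrac e = tofrac n ->
  tofrac (d n) = frac_der x * tofrac e + x * tofrac (d e).
Proof.
move=> e0 xe; rewrite /frac_der.
have := frac_repr x; have := denom_ratioP (repr x).
move: \n_(repr x) \d_(repr x) => n' e' e'0 xE.
have te'0 : tofrac e' != 0 by rewrite tofrac_eq0.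
have xe' : x * tofrac e' = tofrac n' by rewrite xE divfK.
have /(congr1 (fun z => tofrac (d z))) : n * e' = n' * e.
  by apply/eqP; rewrite -tofrac_eq !tofracM -xe -xe' mulrAC.
rewrite !dM !tofracD !tofracM -xe -xe' => /(canRL (addrK _)) H.
apply: (mulIf te'0); rewrite H mulrDl [_ / _ * _ * _]mulrAC divfK //.
by ring.
Qed.

Lemma frac_der_tofrac a : frac_der (tofrac a) = tofrac (d a).
Proof.
have d1 : d 1 = 0 by apply: (addrI (d 1)); rewrite -{3}[1]mulr1 dM mulr1 mul1r addr0.
have a1 : tofrac a * tofrac 1 = tofrac a by rewrite tofrac1 mulr1.
by rewrite (frac_derE (oner_neq0 R) a1) d1 tofrac0 mulr0 addr0 tofrac1 mulr1.
Qed.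

(** [frac_derE] is applied over the denominator [e * e'], then for [x] and [y] to eliminate [d n]
    and [d n']; cancelling the denominator leaves a ring identity. The product rule is obtained in
    the same way. *)
Lemma frac_derD : {morph frac_der : x y / x + y}.
Proof.
move=> x y; have := frac_repr x; have := denom_ratioP (repr x).
have := frac_repr y; have := denom_ratioP (repr y).
move: \n_(repr x) \d_(repr x) \n_(repr y) \d_(repr y) => n e n' e' e'0 yE e0 xE.
have xe : x * tofrac e = tofrac n by rewrite xE divfK ?tofrac_eq0.
have ye : y * tofrac e' = tofrac n' by rewrite yE divfK ?tofrac_eq0.
have ee'0 : e * e' != 0 by rewrite mulf_neq0.
have xyee' : (x + y) * tofrac (e * e') = tofrac (n * e' + n' * e).
  by rewrite !(tofracD, tofracM) -xe -ye; ring.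
have := frac_derE ee'0 xyee'.
rewrite ?dD !dM !(tofracD, tofracM) (frac_derE e0 xe) (frac_derE e'0 ye) -xe -ye.
move=> /eqP; rewrite -subr_eq => /eqP H.
have tee'0 : tofrac e * tofrac e' != 0 by rewrite mulf_neq0 ?tofrac_eq0.
by apply: (mulIf tee'0); rewrite -H; ring.
Qed.

Lemma frac_derM x y : frac_der (x * y) = frac_der x * y + x * frac_der y.
Proof.
have := frac_repr x; have := denom_ratioP (repr x).
have := frac_repr y; have := denom_ratioP (repr y).
move: \n_(repr x) \d_(repr x) \n_(repr y) \d_(repr y) => n e n' e' e'0 yE e0 xE.
have xe : x * tofrac e = tofrac n by rewrite xE divfK ?tofrac_eq0.
have ye : y * tofrac e' = tofrac n' by rewrite yE divfK ?tofrac_eq0.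
have ee'0 : e * e' != 0 by rewrite mulf_neq0.
have xyee' : (x * y) * tofrac (e * e') = tofrac (n * n').
  by rewrite !(tofracD, tofracM) -xe -ye; ring.
have := frac_derE ee'0 xyee'.
rewrite ?dD !dM !(tofracD, tofracM) (frac_derE e0 xe) (frac_derE e'0 ye) -xe -ye.
move=> /eqP; rewrite -subr_eq => /eqP H.
have tee'0 : tofrac e * tofrac e' != 0 by rewrite mulf_neq0 ?tofrac_eq0.
by apply: (mulIf tee'0); rewrite -H; ring.
Qed.

End FracDerivation.

(** * The trace of a finite extension of domains *)

Section FiniteDomain.
Variables (A C : idomainType) (j : {rmorphism A -> C}) (j_inj : injective j).
Hypothesis j_fin : is_finite_over j.

Let frac_map_morphism : {rmorphism {fraction A} -> {fraction C}} :=
  HB.pack (frac_map j)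
    (GRing.isZmodMorphism.Build _ _ _ (frac_map_is_zmod_morphism j_inj))
    (GRing.isMonoidMorphism.Build _ _ _ (frac_map_is_monoid_morphism j_inj)).
Local Notation i := frac_map_morphism.

Let i_tofrac a : i (tofrac a) = tofrac (j a).
Proof. exact: frac_map_tofrac. Qed.

(** A free subfamily spanning all generators spans [C] over the fractions of [A]. Multiplication by
    a nonzero [q] in [C] is injective on this finite-dimensional span, hence bijective, so the span
    also contains every [p / q]. *)
Lemma generators_basis N (g : 'I_N -> C) :
  (forall c, exists a : 'I_N -> A, c = \sum_l j (a l) * g l) ->
  exists n (f : 'I_n -> 'I_N),
    is_field_basis (frac_map j) (fun l => tofrac (g (f l))).
Proof.
move=> gen_g.
have [n [f [P [free_e span_g]]]] := free_subfamily i (fun l => tofrac (g l)).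
pose e l := tofrac (g (f l)).
have spanC c : exists a : 'rV[{fraction A}]_n, tofrac c = \sum_l i (a 0 l) * e l.
  have [a ->] := gen_g c.
  exists ((\row_l tofrac (a l)) *m P); rewrite -mul_comb rmorph_sum.
  apply: eq_bigr => l _; by rewrite mxE i_tofrac -span_g rmorphM.
exists n, f; apply: (@basisP _ _ i) => // y.
rewrite (frac_repr y); have q0 := denom_ratioP (repr y).
move: \n_(repr y) \d_(repr y) q0 => p q q0.
have tq0 : tofrac q != 0 by rewrite tofrac_eq0.
have /fin_all_exists[M HM] m : exists a : 'rV[{fraction A}]_n,
    tofrac q * e m = \sum_l i (a 0 l) * e l by rewrite -tofracM.
(* The matrix of multiplication by [q] on the span of [e]. *)
pose Q : 'M_n := \matrix_m M m.
have mulQ (v : 'rV_n) : \sum_l i ((v *m Q) 0 l) * e l =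
    tofrac q * \sum_l i (v 0 l) * e l.
  rewrite -mul_comb mulr_sumr; apply: eq_bigr => l _; rewrite mulrCA HM.
  by congr (_ * _); apply: eq_bigr => h _; rewrite mxE.
have Qu : Q \in unitmx.
  rewrite -row_free_unit; apply: inj_row_free => v vQ; apply: free_e.
  apply: (mulfI tq0); rewrite mulr0 -mulQ vQ big1 // => l _.
  by rewrite mxE rmorph0 mul0r.
have [a pE] := spanC p; exists (a *m invmx Q).
by apply: (mulfI tq0); rewrite -mulQ mulmxKV // -pE mulrC divfK.
Qed.

Lemma fraction_basis :
  exists n (e : 'I_n -> {fraction C}), is_field_basis (frac_map j) e.
Proof.
have [N [g /generators_basis[n [f He]]]] := j_fin.
by exists n, (fun l => tofrac (g (f l))).
Qed.

(** With [P] the coordinates of the generators in a basis chosen among them, and [b] the action of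
    [c] on the generators, [integral_trace] applies: the rows of [P] selected by [f] form the
    identity. *)
Lemma integral_field_trace c :
  integralOver (@tofrac A) (field_trace (frac_map j) (tofrac c)).
Proof.
have [N [g gen_g]] := j_fin; have [n [f He]] := generators_basis gen_g.
set e := fun l => _ in He.
have [P HP] := basis_mx (i := i) (fun m => tofrac (g m)) He.
have [M HM] := mul_matrix_exists (i := i) (tofrac c) He.
rewrite (field_traceE (i := i) He HM).
have /fin_all_exists[b Hb] m : exists a : 'I_N -> A, c * g m = \sum_l j (a l) * g l.
  exact: gen_g.
apply: (integral_trace (P := P) (f0 := f) (B := \matrix_(m, l) b m l)).
  apply: (basis_mx_inj (i := i) He) => l.
  under eq_bigr => h _ do rewrite mxE.
  by rewrite -HP (scalar_comb i).
have cg m : tofrac c * tofrac (g m) = \sum_l tofrac (j (b m l)) * tofrac (g l).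
  by rewrite -tofracM Hb rmorph_sum; apply: eq_bigr => l _; rewrite rmorphM.
(* Row [m] on either side holds the coordinates of [c * g m]. *)
apply: (basis_mx_inj (i := i) He) => m; rewrite -!mul_comb.
under eq_bigr => h _ do rewrite -HP 2!mxE i_tofrac.
rewrite -cg HP mulr_sumr; apply: eq_bigr => l _.
by rewrite -HM mulrCA.
Qed.

(** Normality puts the integral trace in [A], so [xget] does not fall back on its default value. *)
Lemma tofrac_trace_over c : is_normal A ->
  tofrac (trace_over j c) = field_trace (frac_map j) (tofrac c).
Proof.
move=> /(_ _ (integral_field_trace c))[a Ha].
have := @xgetPex _ 0 [set a | tofrac a = field_trace (frac_map j) (tofrac c)]%classic.
by apply; exists a.
Qed.

Lemma trace_over_linear a c c' : is_normal A ->
  trace_over j (j a * c + c') = a * trace_over j c + trace_over j c'.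
Proof.
move=> hA; have [n [e He]] := fraction_basis.
move: (tofrac_trace_over^~ hA); move: (trace_over j) => t tE.
apply/eqP; rewrite -tofrac_eq tofracD tofracM !tE tofracD tofracM -i_tofrac.
by rewrite (field_trace_linear (i := i) _ _ _ He).
Qed.

(** Injectivity of [j] makes [dA] a derivation, so [field_trace_derivation] applies to the
    extensions of [dA] and [dC] to the fraction fields. *)
Lemma trace_over_derivation (dA : A -> A) (dC : C -> C) c : is_normal A ->
  {morph dC : x y / x + y} -> (forall x y, dC (x * y) = dC x * y + x * dC y) ->
  (forall a, j (dA a) = dC (j a)) ->
  trace_over j (dC c) = dA (trace_over j c).
Proof.
move=> hA dCD dCM jd; have [n [e He]] := fraction_basis.
have dAD : {morph dA : x y / x + y}.
  by move=> x y; apply: j_inj; rewrite rmorphD !jd rmorphD dCD.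
have dAM x y : dA (x * y) = dA x * y + x * dA y.
  by apply: j_inj; rewrite rmorphD !rmorphM !jd rmorphM dCM.
move: (tofrac_trace_over^~ hA); move: (trace_over j) => t tE.
apply/eqP; rewrite -tofrac_eq -(frac_der_tofrac dAM) !tE -(frac_der_tofrac dCM).
apply/eqP; apply: (field_trace_derivation (i := i) _ He).
- exact: frac_derD.
- exact: frac_derD.
- exact: frac_derM.
(* The two extensions agree along [frac_map j]: [x * q = p] is differentiated in both fields and the
   common terms are cancelled. *)
move=> x; have := frac_repr x; have := denom_ratioP (repr x).
move: \n_(repr x) \d_(repr x) => p q q0 xE.
have xq : x * tofrac q = tofrac p by rewrite xE divfK ?tofrac_eq0.
have jxq : i x * tofrac (j q) = tofrac (j p) by rewrite -!i_tofrac -rmorphM xq.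
have tjq0 : tofrac (j q) != 0 by rewrite tofrac_eq0 j_neq0.
apply: (mulIf tjq0); apply: (addIr (i x * tofrac (dC (j q)))).
rewrite -(frac_derE dCM (j_neq0 j_inj q0) jxq) -!jd -!i_tofrac -!rmorphM -rmorphD.
by rewrite -(frac_derE dAM q0 xq).
Qed.

End FiniteDomain.

(** * Restriction of the Poisson trace order to the subalgebra *)

Lemma is_poisson_subalgebra_bracket (k : comPzRingType) (A C : comAlgType k)
    (j : {lrmorphism A -> C}) (brA : A -> A -> A) (brC : C -> C -> C) :
  is_poisson_bracket brC -> is_poisson_subalgebra j brA brC ->
  is_poisson_bracket brA.
Proof.
case=> linl linr alt jac leib [j_inj jbr]; split.
- by move=> t a b c; apply: j_inj; rewrite jbr linearP linl -!jbr linearP.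
- by move=> t a b c; apply: j_inj; rewrite jbr linearP linr -!jbr linearP.
- by move=> a; apply: j_inj; rewrite jbr alt rmorph0.
- by move=> a b c; apply: j_inj; rewrite rmorph0 -(jac (j a) (j b) (j c)) -!jbr !rmorphD.
- by move=> a b c; apply: j_inj; rewrite jbr rmorphM leib -!jbr rmorphD !rmorphM.
Qed.

Lemma finite_trans (R : nzRingType) (C A : comNzRingType)
    (iota : {rmorphism C -> R}) (j : A -> C) :
  (exists n (r : 'I_n -> R), forall x, exists a : 'I_n -> C,
    x = \sum_l iota (a l) * r l) ->
  is_finite_over j ->
  exists n (r : 'I_n -> R), forall x, exists a : 'I_n -> A,
    x = \sum_l iota (j (a l)) * r l.
Proof.
case=> n [r gen_r] [m [e gen_e]].
pose T : finType := ('I_n * 'I_m)%type.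
pose s (p : T) := iota (e p.2) * r p.1.
exists #|T|, (fun l => s (enum_val l)) => x.
have [a ->] := gen_r x; have /fin_all_exists[b Hb] l := gen_e (a l).
exists (fun l => let p : T := enum_val l in b p.1 p.2).
transitivity (\sum_(p : T) iota (j (b p.1 p.2)) * s p); last first.
  by rewrite (reindex (@enum_val T T)) //; apply/onW_bij/enum_val_bij.
rewrite -(pair_bigA _ (fun l h => iota (j (b l h)) * s (l, h))) /=.
apply: eq_bigr => l _; rewrite {1}Hb rmorph_sum mulr_suml; apply: eq_bigr => h _.
by rewrite rmorphM mulrA.
Qed.

(** The first conjunct certifies that [trace_over j] is the genuine trace of the fraction fields at
    every [c]. *)
Theorem theoremB (k : comPzRingType) (R : algType k) (C : idomainAlgType k)
    (iota : {lrmorphism C -> R}) (brC : C -> C -> C) (der : C -> R -> R)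
    (tr : R -> C)
    (hR : is_poisson_trace_order iota brC der tr)
    (A : idomainAlgType k) (j : {lrmorphism A -> C}) (brA : A -> A -> A)
    (hA : is_poisson_subalgebra j brA brC)
    (hnormal : is_normal A)
    (hfin : is_finite_over j) :
  (forall c : C,
     tofrac (trace_over j c) = field_trace (frac_map j) (tofrac c)) /\
  is_poisson_trace_order (iota \o j) brA (der \o j) (trace_over j \o tr).
Proof.
have [[iota_inj central fin_R brP derP der_lin compat] [tr_lin trC] tr_der] := hR.
have [j_inj jbr] := hA.
split; first by move=> c; apply: tofrac_trace_over.
split=> [|| a x /=]; [split | split |].
- exact: inj_comp.
- by move=> a x; apply: central.
- exact: finite_trans fin_R hfin.
- exact: is_poisson_subalgebra_bracket brP hA.
- by move=> a; apply: derP.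
- by move=> t a b x /=; rewrite linearP der_lin.
- by move=> a b /=; rewrite compat jbr.
- by move=> a x y /=; rewrite tr_lin trace_over_linear.
- by move=> x y /=; rewrite trC.
(* The derivation [brC (j a)] of [C] restricts to [brA a] on [A]. *)
rewrite tr_der; apply: (@trace_over_derivation _ _ j _ _ (brA a)) => //.
- move=> b c.
  by have := poisson_linearr brP 1 b c (j a); rewrite !scale1r.
- by move=> b c; rewrite (poisson_leibniz brP).
- exact: jbr.
Qed.
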